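(* Let $T_\nu(n)$ be as defined in the context and let $\nu(q)=\sum_{n\ge0}(-q)^n(q;q^2)_n$. Then, as formal power series (equivalently for $|q|<1$), $$\sum_{n\ge1}T_\nu(n)q^n=q\,\nu(-q).$$
   Context: $(a;q)_n=\prod_{j=0}^{n-1}(1-aq^j)$, $(a;q)_\infty=\prod_{j\ge0}(1-aq^j)$. A two-color partition is a partition whose parts are each colored blue or green (the same integer may occur in both colors). $T_\nu(n)$ is the signed count of two-color partitions of $n$ such that: all odd parts are blue (and may repeat); even parts may be of either color, but no even part is repeated within the same color; the smallest part is odd. Each such partition is counted with weight $(-1)^j$, where $j$ is the number of blue even parts. Equivalently, $\sum_{n\ge1}T_\nu(n)q^n=\sum_{n\ge0}\frac{q^{2n+1}(-q^{2n+2};q^2)_\infty(q^{2n+2};q^2)_\infty}{(q^{2n+1};q^2)_\infty}$. *)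

(* Defs.v *)
From HB Require Import structures.
From mathcomp Require Import all_boot all_order all_algebra.

Set Implicit Arguments.
Unset Strict Implicit.
Unset Printing Implicit Defensive.

Import GRing.Theory.
Local Open Scope ring_scope.

Definition qpoch (R : nzRingType) (a q : R) (n : nat) : R :=
  \prod_(j < n) (1 - a * q ^+ j).

(* A formal power series is given by its coefficients: f stands for
   \sum_m (f m) q^m. *)
Definition fps := nat -> int.

Definition fps_of_poly (p : {poly int}) : fps := fun m => p`_m.

Definition fps_mul (f g : fps) : fps :=
  fun m => \sum_(i < m.+1) f i * g (m - i)%N.

(* f(- q) *)
Definition fps_subst_opp (f : fps) : fps := fun m => (-1) ^+ m * f m.

(* Convergence of \sum_n (u n) in Z[[q]]: every coefficient of the partial sums
   is eventually constant. *)
Definition fps_sums_to (u : nat -> {poly int}) (s : fps) : Prop :=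
  forall m, exists N, forall k, (N <= k)%N -> (\sum_(n < k) u n)`_m = s m.

Definition nu_term (n : nat) : {poly int} := (- 'X) ^+ n * qpoch 'X 'X^2 n.

(* The n-th term is divisible by q^n, so only n <= m contributes to the
   coefficient of q^m; nuP shows that this is the sum of the series. *)
Definition nu : fps := fun m => (\sum_(n < m.+1) nu_term n)`_m.

Lemma coef_nu_term (n m : nat) : (m < n)%N -> (nu_term n)`_m = 0.
Proof.
by move=> ltmn; rewrite /nu_term exprNn mulrAC coefMXn ltmn.
Qed.

Lemma nuP : fps_sums_to nu_term nu.
Proof.
move=> m; exists m.+1 => k /subnKC <-; rewrite /nu big_split_ord /= coefD.
rewrite [X in _ + X]coef_sum [X in _ + X]big1 ?addr0 // => i _.
by rewrite coef_nu_term // leq_addr.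
Qed.

(* Two-color partitions of n, encoded by multiplicities: p (c, k) is the number
   of parts equal to k and of color c.  Since parts are positive, both the parts
   and the multiplicities are at most n, so that 'I_n.+1 loses nothing. *)
Definition color := bool.
Definition blue : color := true.
Definition green : color := false.

Definition mult_fun (n : nat) := {ffun color * 'I_n.+1 -> 'I_n.+1}.

Definition is_two_color_partition (n : nat) (p : mult_fun n) : bool :=
  [forall c : color, p (c, ord0) == 0%N :> nat] &&
  (\sum_(c : color) \sum_(k < n.+1) k * p (c, k) == n)%N.

Definition occurs (n : nat) (p : mult_fun n) (k : 'I_n.+1) : bool :=
  [exists c : color, 0 < p (c, k)]%N.

Definition odd_parts_blue (n : nat) (p : mult_fun n) : bool :=
  [forall k : 'I_n.+1, odd k ==> (p (green, k) == 0%N :> nat)].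

Definition even_parts_distinct (n : nat) (p : mult_fun n) : bool :=
  [forall c : color, forall k : 'I_n.+1, ~~ odd k ==> (p (c, k) <= 1)%N].

Definition smallest_part_odd (n : nat) (p : mult_fun n) : bool :=
  [exists k : 'I_n.+1, [&& occurs p k, odd k &
    [forall i : 'I_n.+1, occurs p i ==> (k <= i)%N]]].

Definition nu_admissible (n : nat) (p : mult_fun n) : bool :=
  [&& is_two_color_partition p, odd_parts_blue p, even_parts_distinct p &
      smallest_part_odd p].

Definition num_blue_even (n : nat) (p : mult_fun n) : nat :=
  (\sum_(k < n.+1 | ~~ odd k) p (blue, k))%N.

Definition T_nu (n : nat) : int :=
  \sum_(p : mult_fun n | nu_admissible p) (-1) ^+ num_blue_even p.

(* \sum_(n >= 1) T_nu(n) q^n *)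
Definition T_nu_series : fps := fun n => if (1 <= n)%N then T_nu n else 0.

(* Main.v *)
(** The coefficients of degree at most n may be computed in any commutative ring
    with an element q such that q^(n+1) = 0, where all infinite products are
    finite and 1/(1 - q^k) is a finite geometric sum.  With
      A_n = (q^(2n+2);q^2)_oo,  B_n = (-q^(2n+2);q^2)_oo / (q^(2n+1);q^2)_oo,
      C_m = (-q;q^2)_m / (q^2;q^2)_m,
    the generating function of T_nu is sum_n q^(2n+1) A_n B_n.  The q-binomial
    theorem gives B_n = sum_m C_m q^((2n+1)m), so that exchanging the sums (as in
    Heine's transformation) yields sum_m q^(m+1) C_m S_m with
    S_m = sum_n q^((2m+2)n) A_n, and S_m = (q^2;q^2)_m by telescoping.  *)
Require Import Defs.
From mathcomp Require Import all_boot all_order all_algebra.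
From mathcomp Require Import qpoly ring zify.
Local Open Scope ring_scope.
Import GRing.Theory.

Set Implicit Arguments.
Unset Strict Implicit.
Unset Printing Implicit Defensive.

(** * Heine's transformation for a nilpotent q *)

Section NilpotentVariable.
Variables (R : comNzRingType) (q : R) (N : nat).
Hypothesis qN0 : q ^+ N = 0.

Lemma expr_ge_nil0 k : (N <= k)%N -> q ^+ k = 0.
Proof. by move=> /subnK <-; rewrite exprD qN0 mulr0. Qed.

(** Plays the role of 1/(1 - q^k) for k > 0: N terms suffice because (q^k)^N = 0. *)
Definition geom k : R := \sum_(v < N) q ^+ (k * v).

Lemma mul_geom k : (0 < k)%N -> (1 - q ^+ k) * geom k = 1.
Proof.
move=> k_gt0; have -> : geom k = \sum_(v < N) (q ^+ k) ^+ v.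
  by apply: eq_bigr => v _; rewrite exprM.
rewrite -[1 - _]opprB mulNr -subrX1 -exprM expr_ge_nil0 ?leq_pmull //.
by rewrite sub0r opprK.
Qed.

Lemma geom_large k : (0 < k)%N -> (N <= k)%N -> geom k = 1.
Proof.
by move=> /mul_geom + /expr_ge_nil0 qk0; rewrite qk0 subr0 mul1r.
Qed.

Lemma mul_one_subK k : (0 < k)%N -> cancel ( *%R (1 - q ^+ k)) ( *%R (geom k)).
Proof. by move=> k_gt0 x; rewrite mulrA [geom k * _]mulrC mul_geom ?mul1r. Qed.

Lemma mul_geomK k : (0 < k)%N -> cancel ( *%R (geom k)) ( *%R (1 - q ^+ k)).
Proof. by move=> k_gt0 x; rewrite mulrA mul_geom ?mul1r. Qed.

(* A_n, B_n and C_m of the header, with the products cut at N. *)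
Definition even_tail n : R := \prod_(n <= i < N) (1 - q ^+ i.*2.+2).

Definition ratio_tail n : R :=
  \prod_(n <= i < N) ((1 + q ^+ i.*2.+2) * geom i.*2.+1).

Definition qbin_coef m : R := \prod_(i < m) ((1 + q ^+ i.*2.+1) * geom i.*2.+2).

(** Valid beyond the cut as well: for n >= N both products are empty and q^(2n+2) = 0. The same
    holds for [ratio_tailS], so no recurrence below carries a bound on n. *)
Lemma even_tailS n : even_tail n = (1 - q ^+ n.*2.+2) * even_tail n.+1.
Proof.
rewrite /even_tail; case: (ltnP n N) => [ltnN | leNn]; first by rewrite big_ltn.
by rewrite !big_geq ?(leqW leNn) // expr_ge_nil0 ?subr0 ?mulr1 //; lia.
Qed.

Lemma ratio_tailS n :
  ratio_tail n = (1 + q ^+ n.*2.+2) * geom n.*2.+1 * ratio_tail n.+1.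
Proof.
rewrite /ratio_tail; case: (ltnP n N) => [ltnN | leNn].
  by rewrite big_ltn.
rewrite !big_geq ?(leqW leNn) // expr_ge_nil0 ?geom_large ?addr0 ?mulr1 //; lia.
Qed.

Lemma ratio_tailS_mul n :
  (1 - q ^+ n.*2.+1) * ratio_tail n = (1 + q ^+ n.*2.+2) * ratio_tail n.+1.
Proof.
by rewrite ratio_tailS [_ * geom _]mulrC -!mulrA mul_geomK.
Qed.

Lemma qbin_coefS m :
  (1 - q ^+ m.*2.+2) * qbin_coef m.+1 = (1 + q ^+ m.*2.+1) * qbin_coef m.
Proof.
rewrite /qbin_coef big_ord_recr /= [_ * geom _]mulrC [X in _ * X = _]mulrCA.
by rewrite mul_geomK // mulrC.
Qed.

(** The q-binomial series D(z) = sum_m C_m z^m at z = q^(2n+1); the terms with m >= N vanish. *)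
Definition qbin_sum n : R := \sum_(m < N) qbin_coef m * q ^+ (n.*2.+1 * m).

(* With z = q^(2n+1) this is the functional equation
   (1 - z) D(z) = (1 + q z) D(q^2 z), which ratio_tail satisfies as well. *)
Lemma qbin_sumS_mul n :
  (1 - q ^+ n.*2.+1) * qbin_sum n = (1 + q ^+ n.*2.+2) * qbin_sum n.+1.
Proof.
rewrite [q ^+ n.*2.+2]exprS; set z := q ^+ n.*2.+1.
have zN0 : z ^+ N = 0 by rewrite -exprM expr_ge_nil0 // leq_pmull.
have -> : qbin_sum n = \sum_(m < N) qbin_coef m * z ^+ m.
  by apply: eq_bigr => m _; rewrite exprM.
have -> : qbin_sum n.+1 = \sum_(m < N) qbin_coef m * (z ^+ m * q ^+ m.*2).
  apply: eq_bigr => m _; rewrite -exprM -exprD; congr (_ * q ^+ _); lia.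
(* A partial sum satisfies the functional equation up to one boundary term, which is 0 at M = 0
   because of 1 - q^0 and at M = N because of z^N. *)
suff telescope M : (1 - z) * (\sum_(m < M) qbin_coef m * z ^+ m)
    = (1 + q * z) * (\sum_(m < M) qbin_coef m * (z ^+ m * q ^+ m.*2))
      - qbin_coef M * (1 - q ^+ M.*2) * z ^+ M.
  by rewrite telescope zN0 mulr0 subr0.
elim: M => [|M IHM]; first by rewrite !big_ord0 subrr !mulr0 mul0r subrr.
rewrite !big_ord_recr /= doubleS [qbin_coef M.+1 * _]mulrC qbin_coefS.
rewrite mulrDr {}IHM !exprS; ring.
Qed.

Lemma nil_index_gt0 : (0 < N)%N.
Proof.
by rewrite lt0n; apply/eqP => N0; have /eqP := qN0; rewrite N0 expr0 oner_eq0.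
Qed.

(** Both sides obey the same recurrence in n, whose left factor 1 - q^(2n+1) is invertible, and both
    equal 1 once n >= N; hence a descending induction on n. *)
Lemma ratio_tailE n : ratio_tail n = qbin_sum n.
Proof.
have [d] := ubnP (N - n); elim: d n => // d IHd n lt_d.
have [leNn | ltnN] := leqP N n.
  rewrite /ratio_tail big_geq // /qbin_sum (bigD1 (Ordinal nil_index_gt0)) //=.
  rewrite muln0 expr0 mulr1 /qbin_coef big_ord0 big1 ?addr0 // => i i_neq0.
  have i_gt0 : (0 < i)%N by rewrite lt0n.
  by rewrite expr_ge_nil0 ?mulr0 //; nia.
apply: (can_inj (@mul_one_subK n.*2.+1 isT)).
rewrite ratio_tailS_mul qbin_sumS_mul IHd //; lia.
Qed.

Definition tail_sum m : R := \sum_(n < N) q ^+ (m.*2.+2 * n) * even_tail n.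

(** Since q^(2n) A_n = A_n - A_(n-1) for n > 0, the sum collapses to its last A_(N-1), which is 1
    because q^(2N) = 0. *)
Lemma tail_sum0 : tail_sum 0 = 1.
Proof.
suff telescope M : \sum_(n < M.+1) q ^+ (2 * n) * even_tail n = even_tail M.
  rewrite /tail_sum -(ltn_predK nil_index_gt0) telescope.
  rewrite even_tailS (ltn_predK nil_index_gt0) /even_tail big_geq // mulr1.
  by rewrite expr_ge_nil0 ?subr0 //; lia.
elim: M => [|M IHM]; first by rewrite big_ord1 muln0 mul1r.
rewrite big_ord_recr /= {}IHM even_tailS mul2n doubleS; ring.
Qed.

(** Summation by parts with z = q^(2m+2), again from q^(2n) A_n = A_n - A_(n-1). *)
Lemma tail_sumS m : tail_sum m.+1 = (1 - q ^+ m.*2.+2) * tail_sum m.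
Proof.
rewrite /tail_sum; set z := q ^+ m.*2.+2.
have zN0 : z ^+ N = 0 by rewrite -exprM expr_ge_nil0 // leq_pmull.
have -> : \sum_(n < N) q ^+ (m.+1.*2.+2 * n) * even_tail n =
          \sum_(n < N) z ^+ n * q ^+ n.*2 * even_tail n.
  apply: eq_bigr => n _; rewrite -exprM -exprD; congr (q ^+ _ * _); lia.
have -> : \sum_(n < N) q ^+ (m.*2.+2 * n) * even_tail n =
          \sum_(n < N) z ^+ n * even_tail n.
  by apply: eq_bigr => n _; rewrite exprM.
(* The boundary term is z^M A_(M-1), with A_(M-1) written as (1 - q^(2M)) A_M so that it makes
   sense, and is 0, at M = 0. *)
suff telescope M :
    \sum_(n < M) z ^+ n * q ^+ n.*2 * even_tail n =
    (1 - z) * (\sum_(n < M) z ^+ n * even_tail n)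
    + z ^+ M * ((1 - q ^+ M.*2) * even_tail M).
  by rewrite telescope zN0 mul0r addr0.
elim: M => [|M IHM]; first by rewrite !big_ord0 subrr mul0r !mulr0 addr0.
rewrite !big_ord_recr /= mulrDr {}IHM doubleS -[_ * even_tail M.+1]even_tailS.
rewrite exprS; ring.
Qed.

(** S_m = (q^2;q^2)_m cancels the denominator of C_m and leaves (-q;q^2)_m. *)
Lemma qbin_coef_tail_sum m :
  qbin_coef m * tail_sum m = \prod_(i < m) (1 + q ^+ i.*2.+1).
Proof.
elim: m => [|m IHm]; first by rewrite /qbin_coef !big_ord0 tail_sum0 mulr1.
rewrite big_ord_recr /= -{}IHm tail_sumS mulrCA mulrA qbin_coefS; ring.
Qed.

Lemma heine_nilpotent :
  \sum_(n < N) q ^+ n.*2.+1 * even_tail n * ratio_tail n =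
  \sum_(m < N) q ^+ m.+1 * \prod_(i < m) (1 + q ^+ i.*2.+1).
Proof.
under eq_bigr do rewrite ratio_tailE /qbin_sum mulr_sumr.
rewrite exchange_big; apply: eq_bigr => m _.
rewrite -qbin_coef_tail_sum /tail_sum !mulr_sumr; apply: eq_bigr => n _.
have -> : q ^+ n.*2.+1 * even_tail n * (qbin_coef m * q ^+ (n.*2.+1 * m)) =
  q ^+ (n.*2.+1 + n.*2.+1 * m) * (qbin_coef m * even_tail n).
  by rewrite exprD; ring.
(* Both sides are (2n+1)(m+1); the right one isolates the power of q that weights A_n in S_m. *)
have -> : (n.*2.+1 + n.*2.+1 * m = m.+1 + m.*2.+2 * n)%N by lia.
rewrite exprD; ring.
Qed.

End NilpotentVariable.

(** * Partitions as families of independent multiplicities *)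

(* The multiplicities allowed for the part x.2 of color x.1 once the smallest part
   is required to be the odd number j. *)
Definition mult_allowed (n : nat) (j : 'I_n.+1) (x : color * 'I_n.+1) :
    pred 'I_n.+1 := fun v =>
  if (x.2 < j)%N || (odd x.2 && (x.1 == green)) then v == 0%N :> nat
  else if odd x.2 then (x.2 == j) ==> (0 < v)%N else (v <= 1)%N.

Definition total_weight (n : nat) (p : mult_fun n) : nat :=
  (\sum_(c : color) \sum_(k < n.+1) k * p (c, k))%N.

(** Once the smallest part j is fixed, the remaining conditions bear on each multiplicity
    separately; this is what makes the generating function a product. *)
Lemma nu_admissibleP (n : nat) (p : mult_fun n) :
  reflect (total_weight p = n /\
           exists2 j : 'I_n.+1, odd j & p \in family (mult_allowed j))
          (nu_admissible p).
Proof.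
apply: (iffP idP) =>
  [/and4P[/andP[_ /eqP wp] oddP evenP] | [wp [j oddj /familyP pj]]].
  case/existsP=> j /and3P[occj oddj /forallP minj]; split=> //; exists j => //.
  apply/familyP=> -[c k]; rewrite /mult_allowed !unfold_in /=.
  have zero_green (i : 'I_n.+1) : odd i -> p (green, i) = 0%N :> nat.
    by move=> oddi; apply/eqP; have /forallP/(_ i) := oddP; rewrite oddi.
  case: ifP => [/orP[ltkj | /andP[oddk /eqP ->]] | /norP[gekj oddkc]].
  - have := minj k; rewrite leqNgt ltkj implybF => /existsPn/(_ c).
    by rewrite lt0n negbK.
  - by rewrite zero_green.
  - case: ifP oddkc => [oddk /= cb | oddk _]; last first.
      by have /forallP/(_ c)/forallP/(_ k) := evenP; rewrite oddk.
    apply/implyP=> /eqP ->; case/existsP: occj => -[] //.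
      by case: (c) cb.
    by rewrite (zero_green j).
have pjE c k : mult_allowed j (c, k) (p (c, k)) := pj (c, k).
rewrite /mult_allowed /= in pjE.
(* As j is odd it exceeds 0, so the fictitious part 0 lies below j and gets multiplicity 0. *)
have j_gt0 : (0 < j)%N by case: (j : nat) oddj.
have posj : (0 < p (blue, j))%N.
  by have := pjE blue j; rewrite ltnn oddj /= eqxx.
apply/and4P; split.
- rewrite /is_two_color_partition -/(total_weight p) wp eqxx andbT.
  by apply/forallP=> c; have := pjE c ord0; rewrite j_gt0.
- apply/forallP=> k; apply/implyP=> oddk; have := pjE green k.
  by rewrite oddk orbT.
- apply/forallP=> c; apply/forallP=> k; apply/implyP=> evenk; have := pjE c k.
  by rewrite (negbTE evenk) orbF; case: ifP => // _ /eqP ->.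
apply/existsP; exists j; rewrite oddj /=; apply/andP; split.
  by apply/existsP; exists blue.
apply/forallP=> i; apply/implyP=> /existsP[c]; rewrite lt0n leqNgt.
by apply: contra => ltij; have := pjE c i; rewrite ltij.
Qed.

(** If i < j, the multiplicity of the blue part i would be both positive and 0. *)
Lemma mult_allowed_inj (n : nat) (p : mult_fun n) (i j : 'I_n.+1) :
    odd i -> odd j -> p \in family (mult_allowed i) ->
  p \in family (mult_allowed j) -> i = j.
Proof.
wlog leij : i j / (i <= j)%N => [hwlog | oddi oddj /familyP pi /familyP pj].
  by case: (leqP i j) => [|/ltnW] le oi oj pi pj;
    [apply: hwlog | symmetry; apply: hwlog].
apply/val_inj/eqP; rewrite eqn_leq leij leqNgt; apply/negP=> ltij.
have : mult_allowed i (blue, i) (p (blue, i)) := pi _.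
have : mult_allowed j (blue, i) (p (blue, i)) := pj _.
by rewrite /mult_allowed /= ltij ltnn oddi eqxx /= => /eqP ->.
Qed.

Lemma prod_color (R : comNzRingType) (I : finType) (F : color * I -> R) :
  \prod_x F x = \prod_k (F (blue, k) * F (green, k)).
Proof.
rewrite big_split /=.
transitivity (\prod_x F (x.1, x.2)); first by apply: eq_bigr => -[].
by rewrite -(pair_bigA _ (fun c k => F (c, k))) big_bool.
Qed.

Section LocalFactors.
Variables (R : comNzRingType) (q : R).

Definition part_weight (n : nat) (x : color * 'I_n.+1) (v : 'I_n.+1) : R :=
  (if (x.1 == blue) && ~~ odd x.2 then (-1) ^+ v else 1) * q ^+ (x.2 * v).

Lemma prod_part_weight (n : nat) (p : mult_fun n) :
  \prod_x part_weight x (p x) = (-1) ^+ num_blue_even p * q ^+ total_weight p.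
Proof.
rewrite prod_color big_split /= /part_weight /=.
rewrite [X in _ * X](eq_bigr (fun k : 'I_n.+1 => q ^+ (k * p (green, k))));
  last first.
  by move=> k _; rewrite mul1r.
rewrite big_split /= -big_mkcond !prodrXr -mulrA -exprD.
by rewrite /total_weight big_bool.
Qed.

(** Stated over any ring because it is used twice: at 'X, to read off a coefficient, and at the
    class of 'X modulo 'X^(n+1), to be computed. *)
Definition nu_gen (n : nat) : R :=
  \sum_(j < n.+1 | odd j) \prod_x \sum_(v | mult_allowed j x v) part_weight x v.

Lemma nu_genE (n : nat) :
  nu_gen n = \sum_(j < n.+1 | odd j) \sum_(p in family (mult_allowed j))
     (-1) ^+ num_blue_even p * q ^+ total_weight p.
Proof.
apply: eq_bigr => j _; rewrite bigA_distr_big_dep; apply: eq_bigr => p _.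
exact: prod_part_weight.
Qed.
End LocalFactors.

(** After the sums are exchanged, each p of weight n is met for exactly one j if it is admissible
    and for none otherwise; other weights do not reach degree n. *)
Lemma T_nu_coef (n : nat) : T_nu n = (nu_gen 'X n)`_n.
Proof.
rewrite nu_genE coef_sum.
under eq_bigr => j _ do rewrite coef_sum.
rewrite (exchange_big_dep xpredT) //= /T_nu big_mkcond /=.
apply: eq_bigr => p _.
have coefE : ((-1) ^+ num_blue_even p * 'X^(total_weight p) : {poly int})`_n =
    if total_weight p == n then (-1) ^+ num_blue_even p else 0.
  rewrite -[-1 in LHS](rmorphN1 (@polyC int)) -rmorphXn coefMXn /= coefC.
  by rewrite subn_eq0; case: ltngtP.
have [adm | nadm] := nu_admissibleP p.
  have [wp [j oddj pj]] := adm; rewrite (big_pred1 j) ?coefE ?wp ?eqxx // => i.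
  apply/andP/eqP=> [[oddi pi] | ->]; last by [].
  exact: mult_allowed_inj pi pj.
have [/eqP wp | nwp] := boolP (total_weight p == n); last first.
  by rewrite big1 // => j _; rewrite coefE (negbTE nwp).
rewrite big_pred0 // => j; apply/negP=> /andP[oddj pj].
by apply: nadm; split; last exists j.
Qed.

(** * Evaluation of the generating function at a nilpotent q *)

Lemma sum_odd (V : nmodType) (F : nat -> V) (M : nat) :
  \sum_(0 <= j < M.*2 | odd j) F j = \sum_(i < M) F i.*2.+1.
Proof.
elim: M => [|M IHM]; first by rewrite big_ord0 big_geq.
rewrite doubleS big_mkcond !big_nat_recr //= odd_double -big_mkcond.
by rewrite big_ord_recr IHM addr0.
Qed.

Lemma prod_consecutive (R : comNzRingType) (F : nat -> R) (i M : nat) :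
    (i <= M)%N ->
  \prod_(i.*2.+1 <= k < M.*2.+1) F k =
  \prod_(i <= l < M) (F l.*2.+1 * F l.*2.+2).
Proof.
elim: M => [|M IHM]; first by rewrite leqn0 => /eqP ->; rewrite !big_geq.
rewrite leq_eqVlt => /predU1P[-> | ltiM]; first by rewrite !big_geq.
have leiM2 : (i.*2.+1 <= M.*2.+1)%N by rewrite ltnS leq_double.
rewrite [RHS]big_nat_recr //= -IHM // doubleS.
by rewrite big_nat_recr /= ?(leqW leiM2) // big_nat_recr //= mulrA.
Qed.

Section NilpotentEvaluation.
Variables (R : comNzRingType) (q : R) (n : nat).
Hypothesis qn0 : q ^+ n.+1 = 0.
Local Notation geom := (geom q n.+1).

(* Both colors together: the blue even part k contributes 1 - q^k. *)
Definition part_gen k : R :=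
  if odd k then geom k else (1 + q ^+ k) * (1 - q ^+ k).

Lemma sum_parts_le1 (F : nat -> R) : (0 < n)%N ->
  \sum_(v < n.+1 | (v <= 1)%N) F v = F 0%N + F 1%N.
Proof.
case: n => // m _; rewrite big_mkcond !big_ord_recl /= big1 ?addr0 //.
Qed.

(** Factoring out q^j shifts v by one; the top term of [geom j] then becomes q^(j(n+1)) = 0. *)
Lemma sum_parts_gt0 (j : nat) : (0 < j)%N ->
  \sum_(v < n.+1 | (0 < v)%N) q ^+ (j * v) = q ^+ j * geom j.
Proof.
move=> j_gt0; rewrite big_mkcond big_ord_recl /= add0r /geom big_ord_recr /=.
rewrite mulrDr -exprD -mulnS (expr_ge_nil0 qn0 (leq_pmull n.+1 j_gt0)).
rewrite addr0 mulr_sumr.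
by apply: eq_bigr => v _; rewrite -exprD -mulnS.
Qed.

Lemma local_factor (j k : 'I_n.+1) : odd j ->
  (\sum_(v | mult_allowed j (blue, k) v) part_weight q (blue, k) v) *
  (\sum_(v | mult_allowed j (green, k) v) part_weight q (green, k) v) =
  if (k < j)%N then 1 else if k == j then q ^+ j * geom j else part_gen k.
Proof.
move=> oddj; rewrite /part_weight /mult_allowed /= andbF andbT orbF.
have weight0 (F : 'I_n.+1 -> R) :
    F ord0 = 1 -> \sum_(v < n.+1 | v == 0%N :> nat) F v = 1.
  by move=> F0; rewrite (big_pred1 ord0).
case: ltnP => [_ | lejk] /=.
  by rewrite !weight0 ?mul1r // muln0 ?mulr1 //; case: ifP.
have [oddk | evenk] := boolP (odd k).
  rewrite [X in _ * X]weight0 ?mulr1 ?muln0 ?mulr1 //.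
  under eq_bigr do rewrite mul1r.
  have [-> | neq_kj] := eqVneq k j.
    by rewrite sum_parts_gt0 //; case: (j : nat) oddj.
  by rewrite /part_gen oddk.
have k_gt0 : (0 < k)%N by case: (j : nat) oddj lejk => // ? _; apply: leq_trans.
(* Ensures that the multiplicity 1 exists in 'I_n.+1. *)
have n_gt0 : (0 < n)%N by apply: leq_trans k_gt0 _; rewrite -ltnS.
rewrite (sum_parts_le1 (fun v => (-1) ^+ v * q ^+ (k * v))) //.
rewrite (sum_parts_le1 (fun v => 1 * q ^+ (k * v))) // !muln0 !muln1.
have -> : (k == j) = false.
  by apply: contraNF evenk => /eqP ->.
by rewrite /part_gen (negbTE evenk); ring.
Qed.

Lemma prod_local_factors (j : 'I_n.+1) : odd j ->
  \prod_x \sum_(v | mult_allowed j x v) part_weight q x v =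
  q ^+ j * \prod_(j <= k < n.+1) part_gen k.
Proof.
move=> oddj; rewrite prod_color.
under eq_bigr do rewrite local_factor //.
rewrite -(big_mkord xpredT (fun k : nat =>
  if (k < j)%N then 1 else if k == j then q ^+ j * geom j else part_gen k)).
rewrite (@big_cat_nat _ _ _ j) //=; last by rewrite ltnW.
rewrite big_nat big1 ?mul1r; last by move=> k /= ->.
rewrite !(@big_ltn _ _ _ j) // ltnn eqxx /= [part_gen j]/part_gen oddj mulrA.
congr (_ * _).
apply: eq_big_nat => k /andP[ltjk _].
by rewrite ltnNge ltnW // gtn_eqF.
Qed.

Lemma nu_gen_heine :
  nu_gen q n = \sum_(m < n.+1) q ^+ m.+1 * \prod_(i < m) (1 + q ^+ i.*2.+1).
Proof.
rewrite -(heine_nilpotent qn0).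
have part_gen_large k : (n < k)%N -> part_gen k = 1.
  move=> ltnk; rewrite /part_gen (expr_ge_nil0 qn0) // subr0 addr0 mul1r.
  by rewrite (geom_large qn0) ?if_same //; apply: leq_trans ltnk.
(* Extending the product to k <= 2n+2 adds only factors 1 and lets it split into the pairs (2l+1,
   2l+2) with l <= n. *)
transitivity (\sum_(j < n.+1 | odd j)
    q ^+ j * \prod_(j <= k < n.+1.*2.+1) part_gen k).
  apply: eq_bigr => j oddj; rewrite prod_local_factors //.
  rewrite [in RHS](@big_cat_nat _ _ _ n.+1) //=; [|by rewrite ltnW|by lia].
  rewrite [X in _ = _ * (_ * X)]big_nat [X in _ = _ * (_ * X)]big1 ?mulr1 //.
  by move=> k /andP[ltnk _]; rewrite part_gen_large.
(* Here j = 2i+1; the added terms with j > n vanish with q^j. *)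
transitivity (\sum_(i < n.+1) q ^+ i.*2.+1 *
    \prod_(i.*2.+1 <= k < n.+1.*2.+1) part_gen k).
  rewrite -(big_mkord odd (fun j =>
    q ^+ j * \prod_(j <= k < n.+1.*2.+1) part_gen k)).
  rewrite -(sum_odd (fun j => q ^+ j * \prod_(j <= k < n.+1.*2.+1) part_gen k)).
  rewrite [in RHS](@big_cat_nat _ _ _ n.+1) //=; last by lia.
  rewrite [X in _ = _ + X]big_nat_cond [X in _ = _ + X]big1 ?addr0 //.
  by move=> k /andP[/andP[ltnk _] _]; rewrite (expr_ge_nil0 qn0) ?mul0r.
apply: eq_bigr => i _; rewrite -mulrA; congr (_ * _).
rewrite prod_consecutive; last exact: ltnW.
rewrite /even_tail /ratio_tail -big_split /=; apply: eq_bigr => k _.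
by rewrite /part_gen /= odd_double /=; ring.
Qed.

End NilpotentEvaluation.

(** * Passage from the quotient by a power of 'X to coefficients *)

Lemma rmorph_nu_gen (R S : comNzRingType) (f : {rmorphism R -> S}) (q : R) n :
  f (nu_gen q n) = nu_gen (f q) n.
Proof.
rewrite rmorph_sum; apply: eq_bigr => j _; rewrite rmorph_prod.
apply: eq_bigr => x _; rewrite rmorph_sum; apply: eq_bigr => v _.
by rewrite /part_weight rmorphM rmorphXn; case: ifP => _;
  rewrite ?rmorphXn ?rmorphN1 ?rmorph1.
Qed.

(** Equal classes mean equal remainders modulo 'X^N, and a multiple of 'X^N does not affect the
    coefficients below N. *)
Lemma in_qpolyXn_coef (R : comNzRingType) (N i : nat) (p r : {poly R}) :
  (i < N)%N -> in_qpoly 'X^N p = in_qpoly 'X^N r -> p`_i = r`_i.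
Proof.
move=> ltiN /(congr1 val) /=; rewrite mk_monic_Xn (ltn_predK ltiN) => eq_mod.
rewrite (Pdiv.RingMonic.rdivp_eq (monicXn R N) p) eq_mod.
rewrite [in RHS](Pdiv.RingMonic.rdivp_eq (monicXn R N) r).
by rewrite !coefD !coefMXn ltiN.
Qed.

Lemma coef_comp_polyNX (R : comNzRingType) (p : {poly R}) (i : nat) :
  (p \Po - 'X)`_i = (-1) ^+ i * p`_i.
Proof.
have -> : p \Po - 'X = \poly_(k < size p) ((-1) ^+ k * p`_k).
  rewrite comp_polyE poly_def; apply: eq_bigr => k _.
  have -> : (- 'X) ^+ k = (-1) ^+ k *: 'X^k :> {poly R}.
    by rewrite -scaleN1r exprZn.
  by rewrite scalerA mulrC.
by rewrite coef_poly; case: ltnP => // /(nth_default 0) ->; rewrite mulr0.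
Qed.

Theorem theorem4 :
  forall m : nat,
    T_nu_series m = fps_mul (fps_of_poly 'X) (fps_subst_opp nu) m.
Proof.
case=> [|m].
  by rewrite /fps_mul /fps_of_poly big_ord1 coefX mul0r.
rewrite /T_nu_series /= T_nu_coef.
have XN0 : in_qpoly 'X^(m.+2) ('X : {poly int}) ^+ m.+2 = 0.
  rewrite -rmorphXn; apply: val_inj; rewrite /= mk_monic_Xn /=.
  by apply: Pdiv.RingMonic.rmodpp; rewrite monicXn.
(* A truncation of nu(-q), with as many terms as the sum obtained in the quotient by 'X^(m+2). *)
pose nu_opp : {poly int} :=
  \sum_(k < m.+2) 'X ^+ k * \prod_(i < k) (1 + 'X ^+ i.*2.+1).
rewrite (@in_qpolyXn_coef _ m.+2 _ _ ('X * nu_opp)) //; last first.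
  rewrite rmorph_nu_gen nu_gen_heine // rmorphM /nu_opp rmorph_sum mulr_sumr.
  apply: eq_bigr => k _; rewrite rmorphM rmorphXn rmorph_prod mulrA.
  rewrite [_ ^+ k.+1]exprS.
  by congr (_ * _); apply: eq_bigr => i _; rewrite rmorphD rmorph1 rmorphXn.
have nu_termN k : nu_term k \Po - 'X = 'X^k * \prod_(i < k) (1 + 'X^(i.*2.+1)).
  rewrite /nu_term /qpoch rmorphM rmorphXn rmorphN /= comp_polyX opprK.
  rewrite rmorph_prod; congr (_ * _); apply: eq_bigr => i _.
  rewrite rmorphB rmorph1 rmorphM !rmorphXn /= comp_polyX sqrrN mulNr opprK.
  by rewrite -exprM -exprS mul2n.
(* Only the index 1 of the Cauchy product survives, which leaves the coefficient of degree m in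
   nu(-q). *)
rewrite coefXM /fps_mul 2!big_ord_recl big1 => [|i _]; last first.
  by rewrite /fps_of_poly coefX mul0r.
rewrite /fps_of_poly !coefX mul0r mul1r add0r addr0 /= subSS subn0.
rewrite /fps_subst_opp /nu -coef_comp_polyNX rmorph_sum.
(* [nu_opp] has one term more than the partial sum defining [nu] at m; this last term is divisible
   by 'X^(m+1) and does not reach degree m. *)
rewrite /nu_opp big_ord_recr coefD /= coefXnM ltnSn addr0.
by rewrite [in RHS](eq_bigr _ (fun (k : 'I__) _ => nu_termN k)).
Qed.
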